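(* Let $f(t)$ be a real-rooted polynomial of degree one or two with positive integer coefficients and constant coefficient $1$. Let $f(t)=g(t)+t\,h(t)$ be its recursive decomposition. Then both $g(t)$ and $h(t)$ are real-rooted.
   Context: A polynomial with real coefficients is real-rooted if all its (complex) zeros are real, with multiplicities allowed; a nonzero constant polynomial is regarded as real-rooted. Convention: for nonnegative integers $a,k$, $\binom{a}{k}=0$ if $a<k$ and $\binom{a}{0}=1$. Standard binomial expansion: for integers $i\ge 1$ and $c\ge 1$ there is a unique expansion (the standard $i$-th binomial expansion of $c$) $$c=\binom{a_i}{i}+\binom{a_{i-1}}{i-1}+\cdots+\binom{a_j}{j}$$ with integers $a_i>a_{i-1}>\cdots>a_j\ge j\ge 1$, $j\le i$; the integers $j,a_j,\dots,a_i$ depend on $c$ (and $i$). Recursive decomposition (Mu--Welker): let $d\ge1$ and $f(t)=1+\sum_{i=1}^d c_i t^i$ with all $c_i$ positive integers. For each $i\in\{1,\dots,d\}$ take separately the standard $i$-th binomial expansion $c_i=\sum_{r=j}^{i}\binom{a_r}{r}$ and set $$g_i=\sum_{r=j}^{i}\binom{a_r-1}{r},\qquad h_{i-1}=\sum_{r=j}^{i}\binom{a_r-1}{r-1}.$$ Define $g(t)=1+\sum_{i=1}^d g_i t^i$ and $h(t)=\sum_{i=1}^d h_{i-1}t^{i-1}$. Then $f(t)=g(t)+t\,h(t)$, and this is called the recursive decomposition of $f$. *)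

(* Defs.v *)
From mathcomp Require Import all_boot all_order all_algebra.
From mathcomp Require Import reals complex.

Set Implicit Arguments.
Unset Strict Implicit.
Unset Printing Implicit Defensive.

Import GRing.Theory.
Local Open Scope ring_scope.

(* The zero polynomial is not real-rooted; nonzero constants are. *)
Definition real_rooted (R : realType) (p : {poly R}) : Prop :=
  forall z : R[i], root (map_poly (real_complex R) p) z -> complex.Im z = 0.

Definition poly_of_nat (R : realType) (p : {poly nat}) : {poly R} :=
  map_poly (fun n : nat => n%:R) p.

(* c = 'C(a_i, i) + ... + 'C(a_j, j) with a_i > ... > a_j >= j >= 1;
   the values of a outside {j, ..., i} are irrelevant. *)
Definition binomial_expansion (i c j : nat) (a : nat -> nat) : Prop :=
  [/\ (1 <= j <= i)%N,
      (j <= a j)%N,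
      (forall r, (j <= r < i)%N -> (a r < a r.+1)%N)
    & c = (\sum_(j <= r < i.+1) 'C(a r, r))%N].

(* j i and a i are the lower index and the entries of the i-th binomial
   expansion of the coefficient f`_i. *)
Definition recursive_decomposition (f g h : {poly nat}) : Prop :=
  exists (j : nat -> nat) (a : nat -> nat -> nat),
    [/\ (forall i, (1 <= i < size f)%N -> binomial_expansion i (f`_i)%R (j i) (a i)),
        g = 1 + \sum_(1 <= i < size f)
                  (\sum_(j i <= r < i.+1) 'C((a i r).-1, r))%N *: 'X^i
      & h = \sum_(1 <= i < size f)
              (\sum_(j i <= r < i.+1) 'C((a i r).-1, r.-1))%N *: 'X^(i.-1)].

Lemma binomial_expansion_ltn i c j a :
  binomial_expansion i c j a -> (c < 'C((a i).+1, i))%N.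
Proof.
elim: i c => [|i IHi] c [/andP[j1 ji] ja amon ->]; first by case: j j1 ji {ja amon}.
rewrite big_nat_recr //= addnC binS ltn_add2l.
have [ij|ij] := leqP j i; last first.
  have jE : j = i.+1 by apply/eqP; rewrite eqn_leq ji.
  by rewrite big_geq // bin_gt0 ltnW // -jE.
have ijb : (j <= i < i.+1)%N by rewrite ij /=.
have lta := amon i ijb.
apply: leq_trans (leq_bin2l _ lta); apply: IHi; split=> //.
- by rewrite j1.
- by move=> r /andP[jr ri]; apply: amon; rewrite jr ltnW.
Qed.

Lemma binomial_expansion_exists i c : (0 < i)%N -> (0 < c)%N ->
  {ja : nat * (nat -> nat) | binomial_expansion i c ja.1 ja.2}.
Proof.
elim: i c => // i IHi c _ c_gt0.
have exP : exists n, ('C(n, i.+1) <= c)%N by exists 0.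
have ubP n : ('C(n, i.+1) <= c)%N -> (n <= c + i)%N.
  move=> leC; rewrite leqNgt; apply/negP => /(leq_bin2l i.+1)/leq_trans/(_ leC).
  rewrite leqNgt => /negP; apply; rewrite -addnS.
  elim: {c_gt0 exP leC} c => [|c IHc]; first by rewrite add0n binn.
  rewrite addSn binS -addn1 leq_add //= bin_gt0.
  by rewrite addnS ltnW // ltnS leq_addl.
case: (ex_maxnP exP ubP) => m leC maxm.
have lei : (i < m)%N by apply: maxm; rewrite binn.
have ltC : (c < 'C(m.+1, i.+1))%N.
  by rewrite ltnNge; apply/negP => /maxm; rewrite ltnn.
have [c0|c_neq0] := posnP (c - 'C(m, i.+1)).
  exists (i.+1, fun=> m); split=> //=.
  - by move=> r /andP[/leq_ltn_trans/[apply]]; rewrite ltnn.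
  - by rewrite big_nat1; apply/eqP; rewrite eqn_leq leC -subn_eq0 c0.
have ltr : (c - 'C(m, i.+1) < 'C(m, i))%N by rewrite ltn_subLR // -binS.
have i_gt0 : (0 < i)%N.
  by case: i ltr {IHi exP ubP leC maxm lei ltC} c_neq0 => // ; rewrite bin0; case: subn.
have [[j a] /= [/andP[j1 ji] ja amon ceq]] := IHi _ i_gt0 c_neq0.
exists (j, fun r => if r == i.+1 then m else a r); split=> /=.
- by rewrite j1 ltnW // ltnS.
- by rewrite ltn_eqF // ltnS.
- move=> r /andP[jr]; rewrite ltnS eqSS => ri.
  rewrite ltn_eqF ?ltnS //; have [->|nri] := eqVneq r i; last first.
    by apply: amon; rewrite jr ltn_neqAle nri.
  rewrite ltnNge; apply/negP => /(leq_bin2l i) le_ma.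
  have : ('C(a i, i) <= c - 'C(m, i.+1))%N.
    by rewrite ceq big_nat_recr //= leq_addl.
  by move=> /(leq_trans le_ma); rewrite leqNgt ltr.
- rewrite big_nat_recr ?leqW //= eqxx.
  rewrite (eq_big_nat _ _ (F2 := fun r => 'C(a r, r))); last first.
    by move=> r /andP[_ ri]; rewrite ltn_eqF.
  by rewrite -ceq subnK.
Qed.

Lemma binomial_expansion_unique i c j a j' a' :
  binomial_expansion i c j a -> binomial_expansion i c j' a' ->
  j = j' /\ (forall r, (j <= r <= i)%N -> a r = a' r).
Proof.
have geC k d l b : binomial_expansion k d l b -> ('C(b k, k) <= d)%N.
  by case=> /andP[_ lk] _ _ ->; rewrite big_nat_recr //= leq_addl.
have le_top k d l b l' b' : binomial_expansion k d l b ->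
    binomial_expansion k d l' b' -> (b k <= b' k)%N.
  move=> /geC le1 /binomial_expansion_ltn lt2; rewrite leqNgt; apply/negP.
  by move=> /(leq_bin2l k) /leq_trans/(_ le1); rewrite leqNgt lt2.
have gt0 k d l b : binomial_expansion k d l b -> (0 < d)%N.
  move=> [/andP[l1 lk] lb _ ->]; rewrite big_ltn ?ltnS //.
  by rewrite ltn_addr // bin_gt0.
have tail k d l b : (l <= k)%N -> binomial_expansion k.+1 d l b ->
    binomial_expansion k (d - 'C(b k.+1, k.+1)) l b.
  move=> lk [/andP[l1 _] lb bm ->]; split=> //; first by rewrite l1.
    by move=> r /andP[lr rk]; apply: bm; rewrite lr ltnW.
  by rewrite big_nat_recr ?leqW //= addnK.
have top k d l b : (k < l)%N -> binomial_expansion k.+1 d l b ->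
    (d - 'C(b k.+1, k.+1) = 0)%N.
  move=> kl [/andP[_ lk] _ _ ->]; have -> : l = k.+1 by apply/eqP; rewrite eqn_leq lk.
  by rewrite big_nat1 subnn.
elim: i c => [|i IHi] c H H'; first by case: H => /andP[]; case: (j).
have Ei : a i.+1 = a' i.+1.
  by apply/eqP; rewrite eqn_leq (le_top _ _ _ _ _ _ H H') ?(le_top _ _ _ _ _ _ H' H).
have [ji|ij] := leqP j i; have [j'i|ij'] := leqP j' i.
- have := tail _ _ _ _ j'i H'; rewrite -Ei => /(IHi _ (tail _ _ _ _ ji H))[-> E].
  split=> // r; have [->|ne] := eqVneq r i.+1; first by [].
  by move=> /andP[jr ri]; apply: E; rewrite jr -ltnS ltn_neqAle ne.
- by have := gt0 _ _ _ _ (tail _ _ _ _ ji H); rewrite Ei (top _ _ _ _ ij' H').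
- by have := gt0 _ _ _ _ (tail _ _ _ _ j'i H'); rewrite -Ei (top _ _ _ _ ij H).
- have jE : j = i.+1 by case: H => /andP[_ j1] _ _ _; apply/eqP; rewrite eqn_leq j1.
  have jE' : j' = i.+1 by case: H' => /andP[_ j1] _ _ _; apply/eqP; rewrite eqn_leq j1.
  split=> [|r]; first by rewrite jE jE'.
  by rewrite jE -eqn_leq => /eqP <-.
Qed.

Lemma recursive_decomposition_exists (f : {poly nat}) :
  (forall i, (i < size f)%N -> (0 < (f`_i)%R)%N) ->
  exists g h, recursive_decomposition f g h.
Proof.
move=> fpos.
pose ja i : nat * (nat -> nat) :=
  match posnP i, posnP (f`_i)%R with
  | PosNotEq0 i0, PosNotEq0 c0 => sval (binomial_expansion_exists i0 c0)
  | _, _ => (0%N, id)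
  end.
exists (1 + \sum_(1 <= i < size f)
  (\sum_((ja i).1 <= r < i.+1) 'C(((ja i).2 r).-1, r))%N *: 'X^i).
exists (\sum_(1 <= i < size f)
  (\sum_((ja i).1 <= r < i.+1) 'C(((ja i).2 r).-1, r.-1))%N *: 'X^(i.-1)).
exists (fun i => (ja i).1), (fun i => (ja i).2); split=> // i /andP[i0 ifs].
rewrite /ja; case: posnP => [i00|i1]; first by rewrite i00 in i0.
case: posnP => [c0|c1]; first by move: (fpos _ ifs); rewrite c0.
exact: svalP (binomial_expansion_exists i1 c1).
Qed.

Lemma recursive_decompositionE (f g h : {poly nat}) :
  f`_0 = 1 -> recursive_decomposition f g h -> f = g + 'X * h.
Proof.
move=> f0 [j [a [ex -> ->]]].
have sf : (0 < size f)%N by case: (posnP (size f)) => // s0; move: f0; rewrite nth_default ?s0.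
rewrite -addrA mulr_sumr -big_split /= -[LHS]coefK poly_def.
rewrite -(big_mkord xpredT (fun i => f`_i *: 'X^i)) big_ltn // f0 expr0 scale1r.
congr (_ + _); apply: eq_big_nat => i /andP[i0 ifs].
have [/andP[j1 ji] ja am ceq] := ex i (introT andP (conj i0 ifs)).
rewrite -scalerAr -exprS prednK // -scalerDl; congr (_ *: _).
rewrite [LHS]ceq -[RHS]big_split /=; apply: eq_big_nat => r /andP[jr ri].
have : (0 < a i r)%N.
  apply: leq_trans (leq_trans j1 ja) _.
  elim: r jr ri => [|r IHr]; first by rewrite leqn0 => /eqP ->.
  rewrite leq_eqVlt => /orP[/eqP -> //|]; rewrite ltnS => jr ri.
  by rewrite (leq_trans (IHr jr (ltnW ri))) // ltnW // am // jr -ltnS.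
have r0 : (0 < r)%N := leq_trans j1 jr.
by case: (a i r) => // n _; rewrite -(prednK r0) binS.
Qed.

(* Main.v *)
(* In degree two, f = 1 + c t + d t^2 with 4 d <= c^2, and g has the form
   1 + (c - 1) t + e t^2; h is 1 or linear with constant term 1. Put k = d - e.
   If 4 e > (c - 1)^2, then 2 c - 1 > 4 k, so c - 1 >= 2 k and hence k^2 < e.
   But with 'C(a, 2) the leading term of the expansion of d, either k = a - 1
   and e = 'C(a - 1, 2), or k = a and e < 'C(a - 1, 2) + a - 1; in both cases
   e <= k^2. *)
Require Import Defs.
From mathcomp Require Import all_boot all_order all_algebra.
From mathcomp Require Import reals complex.
From mathcomp Require Import zify ring lra.

Import Order.TTheory GRing.Theory Num.Theory.
Local Open Scope ring_scope.

(** The two equations are the real and imaginary parts of the value at [x + iy]; the second has the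
    factor [y]. *)
Lemma rootE_quadratic (R : realType) (c d : nat) (x y : R) :
  root (map_poly (real_complex R)
         (poly_of_nat R (1 + c *: 'X^1 + d *: 'X^2))) (x +i* y)%C <->
  1 + c%:R * x + d%:R * (x ^+ 2 - y ^+ 2) = 0 /\ (c%:R + 2 * d%:R * x) * y = 0.
Proof.
have -> : map_poly (real_complex R) (poly_of_nat R (1 + c *: 'X^1 + d *: 'X^2)) =
    1 + (c%:R)%:P * 'X + (d%:R)%:P * 'X^2.
  apply/polyP => i; rewrite coef_map /= coef_map_id0 //.
  rewrite !coefD !coefZ !coefCM !coefXn coefX !coef1.
  by case: i => [|[|[|i]]] /=; rewrite ?mulr0 ?mulr1 ?addr0 ?add0r ?rmorph_nat ?rmorph0 ?rmorph1.
rewrite rootE !hornerE /= -[c%:R](rmorph_nat (real_complex R)).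
rewrite -[d%:R](rmorph_nat (real_complex R)) expr2.
split.
  rewrite eq_complex /= => /andP[/eqP e1 /eqP e2].
  by split; [rewrite -[RHS]e1 | rewrite -[RHS]e2]; ring.
move=> [e1 e2]; rewrite eq_complex /=.
by apply/andP; split; apply/eqP; [rewrite -[RHS]e1 | rewrite -[RHS]e2]; ring.
Qed.

(** Allowing [d = 0] makes this criterion serve linear and constant polynomials as well. *)
Lemma real_rooted_quadraticP (R : realType) (c d : nat) :
  real_rooted (poly_of_nat R (1 + c *: 'X^1 + d *: 'X^2)) <->
  (4 * d <= c ^ 2)%N.
Proof.
rewrite -(ler_nat R) natrM natrX; split=> [rr|disc].
  rewrite leNgt; apply/negP => disc.
  have d_gt0 : 0 < d%:R :> R by have := sqr_ge0 (c%:R : R); lra.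
  have s_gt0 : 0 < Num.sqrt (4 * d%:R - c%:R ^+ 2) :> R by rewrite sqrtr_gt0 subr_gt0.
  set s := Num.sqrt _ in s_gt0.
  have s2 : s ^+ 2 = 4 * d%:R - c%:R ^+ 2 by rewrite sqr_sqrtr // subr_ge0 ltW.
  have d_neq0 : d%:R != 0 :> R by rewrite gt_eqF.
  (* The quadratic formula gives the root [(- c + i s) / (2 d)], not real since [s > 0]. *)
  have /rr /= /eqP : root (map_poly (real_complex R)
      (poly_of_nat R (1 + c *: 'X^1 + d *: 'X^2)))
      ((- c%:R / (2 * d%:R)) +i* (s / (2 * d%:R)))%C.
    apply/rootE_quadratic; split; last by field.
    by rewrite !expr_div_n s2; field.
  by rewrite gt_eqF // divr_gt0 // mulr_gt0.
case=> x y /rootE_quadratic[e1 /eqP]; rewrite mulf_eq0 => /orP[/eqP e2|/eqP//].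
(* If [c + 2 d x = 0], then [c ^ 2 = 4 d ^ 2 x ^ 2] and [d = d ^ 2 (x ^ 2 + y ^ 2)], so
   [4 d <= c ^ 2] forces [(d y) ^ 2 <= 0]. *)
have cE : c%:R = - (2 * d%:R * x) by lra.
have dE : 1 = d%:R * (x ^+ 2 + y ^+ 2) by move: e1; rewrite cE; lra.
have : (d%:R * y) ^+ 2 <= 0.
  have dE2 : d%:R = d%:R ^+ 2 * (x ^+ 2 + y ^+ 2) :> R by rewrite expr2 -mulrA -dE mulr1.
  have := disc; rewrite cE; lra.
rewrite le_eqVlt ltNge sqr_ge0 orbF sqrf_eq0 mulf_eq0 => /orP[/eqP d0|/eqP//].
by move: dE; rewrite d0 mul0r => /eqP; rewrite oner_eq0.
Qed.

Lemma binomial_expansion1 (c j : nat) (a : nat -> nat) :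
  binomial_expansion 1 c j a -> j = 1%N /\ a 1%N = c.
Proof.
case=> /andP[j1 j2] _ _ ->; have -> : j = 1%N by apply/eqP; rewrite eqn_leq j1 j2.
by rewrite big_nat1 bin1.
Qed.

Lemma discriminant_decomposition (c d j : nat) (a : nat -> nat) :
  binomial_expansion 2 d j a -> (4 * d <= c ^ 2)%N ->
  (4 * \sum_(j <= r < 3) 'C((a r).-1, r) <= c.-1 ^ 2)%N.
Proof.
have binE n : (2 * 'C(n.+1, 2) = n.+1 * n)%N by rewrite -mul_bin_diag bin1.
have key k e : (4 * (e + k) <= c ^ 2 -> e <= k ^ 2 -> 4 * e <= c.-1 ^ 2)%N.
  (* If [c <= 2 k], then [4 e <= c ^ 2 - 4 k <= c ^ 2 - 2 c]; otherwise [2 k <= c - 1] and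
     [4 e <= (2 k) ^ 2]. *)
  by have [?|?] := leqP c (2 * k); nia.
case=> /andP[j1 j2] ja amon ->.
have [jE|jE] : j = 1%N \/ j = 2%N by lia.
  subst j; rewrite !(@big_nat_recr _ _ _ 2 1) ?big_nat1 //= !bin1.
  move: ja (amon 1%N isT); case: (a 1%N) (a 2%N) => [|b] [|[|m]] //= _ lt_bm.
  rewrite [in X in (X <= _)%N -> _]binS bin1 => disc.
  (* Pascal's rule lowers the quadratic term by [m.+1] and the linear term drops by 1, so
     [k = m.+2]. *)
  apply: (key m.+2); last by have := binE m; nia.
  by apply: leq_trans disc; lia.
subst j; rewrite !big_nat1; case: (a 2%N) ja => [|[|m]] //= _.
rewrite [in X in (X <= _)%N -> _]binS bin1 => /key; apply.
by have := binE m; nia.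
Qed.

Theorem proposition6p1 (R : realType) (f g h : {poly nat})
    (deg_f : size f = 2%N \/ size f = 3%N)
    (f_pos : forall i : nat, (i < size f)%N -> (0 < (f`_i)%R)%N)
    (f0 : f`_0 = 1)
    (f_real : real_rooted (poly_of_nat R f))
    (dec : recursive_decomposition f g h) :
  real_rooted (poly_of_nat R g) /\ real_rooted (poly_of_nat R h).
Proof.
have linear_real_rooted (c : nat) : real_rooted (poly_of_nat R (1 + c *: 'X^1)).
  rewrite -[_ + _]addr0 -[0](scale0r 'X^2).
  by apply/real_rooted_quadraticP; rewrite muln0.
case: dec => j [a [ex -> ->]].
case: deg_f => sf; rewrite sf in ex *.
  have [jE _] := binomial_expansion1 _ _ _ (ex 1%N isT).
  rewrite !big_nat1 jE !big_nat1; split; first exact: linear_real_rooted.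
  (* In degree one [h] is the constant 1, viewed as a linear polynomial with zero slope. *)
  rewrite bin0 expr0 scale1r -[1]addr0 -[0](scale0r 'X^1).
  exact: linear_real_rooted.
have [jE aE] := binomial_expansion1 _ _ _ (ex 1%N isT).
rewrite !(@big_nat_recr _ _ _ 2 1) ?big_nat1 //= jE !big_nat1 bin0 bin1 aE.
(* Here [h] is 1 plus a natural multiple of ['X], real-rooted whatever the multiple. *)
rewrite expr0 scale1r; split; last exact: linear_real_rooted.
rewrite addrA; apply/real_rooted_quadraticP.
apply: discriminant_decomposition (ex 2%N isT) _.
apply/(real_rooted_quadraticP R); suff <- : f = 1 + f`_1 *: 'X^1 + f`_2 *: 'X^2 by [].
apply/polyP => i; rewrite !coefD !coefZ !coefXn coef1.
case: i => [|[|[|i]]] /=; rewrite ?mulr0 ?mulr1 ?addr0 ?add0r //.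
by rewrite nth_default ?sf.
Qed.
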